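(* Let $d\ge 1$ and let $n_1,\ldots,n_d$ be positive integers, each of which is either $2$ or a multiple of $4$. Let $G=\prod_{i=1}^d(\mathbb{Z}/n_i\mathbb{Z})$ with Lee distance $\delta$, let $f:\mathbb{R}_+\to\mathbb{R}_+$ be a (strictly) completely monotonic function, and let $u(g,h)=f(\delta(g,h))$ for $g\neq h$ in $G$, with corresponding energy kernel $A$, total energy $E_{\text{tot}}$ and maximal energy $E_{\text{max}}$. Then the fractional energy $(x|Ax)$ over all $x\in V=\mathbb{R}^G$ with $(x|x)=(x|\mathbf{1})=|G|/2$ is minimised by the characteristic vectors $x_{S_{\text{even}}}$ and $x_{S_{\text{odd}}}$ of the checkerboard configurations \[ S_{\text{even}}=\{(j_1,\ldots,j_d)\in G\mid \textstyle\sum_i j_i \text{ even}\},\qquad S_{\text{odd}}=\{(j_1,\ldots,j_d)\in G\mid \textstyle\sum_i j_i \text{ odd}\}, \] and only by these. As a consequence, both the total energy $E_{\text{tot}}(S)$ and the maximal energy $E_{\text{max}}(S)$ among all subsets $S\subseteq G$ with $|S|=|G|/2$ are minimised by $S_{\text{even}}$ and $S_{\text{odd}}$, and only by these.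
   Context: $\mathbb{R}_+$ denotes the positive real numbers. A function $f:\mathbb{R}_+\to\mathbb{R}_+$ is (strictly) completely monotonic if it is $C^\infty$ and $(-1)^k f^{(k)}(x)>0$ for all $x\in\mathbb{R}_+$ and all integers $k\ge 0$. Lee distance: form the graph on $G=\prod_{i=1}^d(\mathbb{Z}/n_i\mathbb{Z})$ in which two elements are joined by an edge if they differ by $\pm(0,\ldots,0,1,0,\ldots,0)$ for some position of the $1$; $\delta(g,h)$ is the length of a shortest path from $g$ to $h$ in this graph. Since all $n_i$ are even, the parity of $\sum_i j_i$ is well defined for $(j_1,\ldots,j_d)\in G$. For $S\subseteq G$ and $h\in S$, put $E_h(S)=\sum_{g\in S\setminus\{h\}}u(h,g)$, $E_{\text{max}}(S)=\max_{h\in S}E_h(S)$ and $E_{\text{tot}}(S)=\sum_{h\in S}E_h(S)$. $V=\mathbb{R}^G$ is the space of real-valued functions on $G$, with inner product $(x|y)=\sum_{g\in G}x(g)y(g)$; $\mathbf{1}\in V$ is the all-one vector; $x_S\in V$ is the characteristic (0/1) vector of $S\subseteq G$. The energy kernel $A$ is the linear map $V\to V$ given by $(Ax)(h)=\sum_{g\in G,\,g\neq 0}u(g,0)\,x(h-g)$. *)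

(* Defs.v *)
From HB Require Import structures.
From mathcomp Require Import all_boot all_order all_algebra.
From mathcomp Require Import all_classical all_reals all_analysis.

Set Implicit Arguments.
Unset Strict Implicit.
Unset Printing Implicit Defensive.

Import Order.TTheory GRing.Theory Num.Theory.
Import numFieldNormedType.Exports.

Local Open Scope ring_scope.

(* A function R_+ -> R_+ is represented by f : R -> R, whose values outside the
   positive half-line are irrelevant; the case k = 0 says that f maps R_+ to
   R_+, and differentiability of every iterated derivative is smoothness. *)
Definition completely_monotonic (R : realType) (f : R -> R) : Prop :=
  forall (k : nat) (x : R), 0 < x ->
    derivable (derive1n k f) x 1 /\ 0 < (-1) ^+ k * derive1n k f x.

Definition is_minimiser (R : realType) (T : Type) (feasible : T -> Prop)
    (F : T -> R) (x : T) : Prop :=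
  feasible x /\ forall y, feasible y -> F x <= F y.

(* Length of a shortest e-path from x to y. A shortest path does not repeat
   vertices, so it suffices to search the lengths below #|T|; the value is #|T|
   when y cannot be reached from x. *)
Definition graph_dist (T : finType) (e : rel T) (x y : T) : nat :=
  find (fun k => [exists p : k.-tuple T, path e x p && (last x p == y)])
       (iota 0 #|T|).

Lemma graph_dist_le (T : finType) (e : rel T) (x : T) (p : seq T) :
  path e x p -> (graph_dist e x (last x p) <= size p)%N.
Proof.
move=> ep; have [szT|] := ltnP (size p) #|T|; last first.
  by apply: leq_trans; rewrite -[leqRHS](size_iota 0); exact: find_size.
rewrite leqNgt; apply/negP => /(before_find 0%N).
rewrite nth_iota// add0n => /existsP; apply.
by exists (in_tuple p); rewrite ep eqxx.
Qed.

Lemma graph_dist_path (T : finType) (e : rel T) (x y : T) : connect e x y ->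
  exists p, [/\ path e x p, last x p = y & size p = graph_dist e x y].
Proof.
move=> /connectP[p ep ->{y}]; case/shortenP: ep => q eq uq _.
have szT : (size q < #|T|)%N.
  by rewrite -[(size q).+1]/(size (x :: q)) -(card_uniqP uq) max_card.
have : (graph_dist e x (last x q) < #|T|)%N.
  exact: leq_ltn_trans (graph_dist_le eq) szT.
move=> /[dup] dT; rewrite -[X in (_ < X)%N](size_iota 0) -has_find.
move=> /(nth_find 0%N); rewrite -/(graph_dist _ _ _) nth_iota// add0n.
by move=> /existsP[t /andP[et /eqP lt]]; exists t; rewrite size_tuple.
Qed.

(* The group prod_i Z/n_i. Note that 'Z_m is Z/m only when m > 1. *)
Definition lee_group (d : nat) (n : 'I_d -> nat) : Type :=
  {dffun forall i : 'I_d, 'Z_(n i)}.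

HB.instance Definition _ (d : nat) (n : 'I_d -> nat) :=
  Finite.on (lee_group n).

Definition lee_zero (d : nat) (n : 'I_d -> nat) : lee_group n :=
  [ffun i => 0].
Definition lee_opp (d : nat) (n : 'I_d -> nat) (g : lee_group n) :
    lee_group n := [ffun i => - g i].
Definition lee_add (d : nat) (n : 'I_d -> nat) (g h : lee_group n) :
    lee_group n := [ffun i => g i + h i].

Fact lee_addA (d : nat) (n : 'I_d -> nat) : associative (@lee_add d n).
Proof. by move=> g h k; apply/ffunP => i; rewrite !ffunE addrA. Qed.
Fact lee_addC (d : nat) (n : 'I_d -> nat) : commutative (@lee_add d n).
Proof. by move=> g h; apply/ffunP => i; rewrite !ffunE addrC. Qed.
Fact lee_add0 (d : nat) (n : 'I_d -> nat) :
  left_id (@lee_zero d n) (@lee_add d n).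
Proof. by move=> g; apply/ffunP => i; rewrite !ffunE add0r. Qed.
Fact lee_addN (d : nat) (n : 'I_d -> nat) :
  left_inverse (@lee_zero d n) (@lee_opp d n) (@lee_add d n).
Proof. by move=> g; apply/ffunP => i; rewrite !ffunE addNr. Qed.

HB.instance Definition _ (d : nat) (n : 'I_d -> nat) :=
  GRing.isZmodule.Build (lee_group n)
    (@lee_addA d n) (@lee_addC d n) (@lee_add0 d n) (@lee_addN d n).

Definition lee_unit (d : nat) (n : 'I_d -> nat) (i : 'I_d) : lee_group n :=
  [ffun j => (j == i)%:R].

Definition lee_adj (d : nat) (n : 'I_d -> nat) : rel (lee_group n) :=
  fun g h => [exists i, (h - g == lee_unit n i) || (h - g == - lee_unit n i)].

Definition lee_dist (d : nat) (n : 'I_d -> nat) (g h : lee_group n) : nat :=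
  graph_dist (@lee_adj d n) g h.

(* Meaningful for g != h only; the definitions below never use the value at
   g = h. *)
Definition lee_potential (R : realType) (d : nat) (n : 'I_d -> nat)
    (f : R -> R) (g h : lee_group n) : R := f (lee_dist g h)%:R.

Definition parity_set (d : nat) (n : 'I_d -> nat) (b : bool) :
    {set lee_group n} :=
  [set j : lee_group n | odd (\sum_i (j i : nat))%N == b]%SET.
Definition S_even (d : nat) (n : 'I_d -> nat) := parity_set n false.
Definition S_odd (d : nat) (n : 'I_d -> nat) := parity_set n true.

Definition energy_at (R : realType) (G : finType) (u : G -> G -> R)
    (S : {set G}) (h : G) : R := \sum_(g in S :\ h) u h g.

(* The default value 0 of the iterated maximum is harmless for a nonempty S
   when u is nonnegative off the diagonal, as all energies are then >= 0. *)
Definition energy_max (R : realType) (G : finType) (u : G -> G -> R)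
    (S : {set G}) : R := \big[Order.max/0]_(h in S) energy_at u S h.

Definition energy_tot (R : realType) (G : finType) (u : G -> G -> R)
    (S : {set G}) : R := \sum_(h in S) energy_at u S h.

Definition inner (R : realType) (G : finType) (x y : {ffun G -> R}) : R :=
  \sum_g x g * y g.

Definition all_one (R : realType) (G : finType) : {ffun G -> R} :=
  [ffun=> 1].

Definition char_vec (R : realType) (G : finType) (S : {set G}) :
    {ffun G -> R} := [ffun g => (g \in S)%:R].

Definition energy_kernel (R : realType) (G : finZmodType) (u : G -> G -> R)
    (x : {ffun G -> R}) : {ffun G -> R} :=
  [ffun h => \sum_(g | g != 0) u g 0 * x (h - g)].

Fact energy_kernel_is_linear (R : realType) (G : finZmodType)
  (u : G -> G -> R) : linear (energy_kernel u).
Proof.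
move=> a x y; apply/ffunP => h; rewrite !ffunE scaler_sumr -big_split /=.
apply: eq_bigr => g _; rewrite !ffunE mulrDr; congr (_ + _).
by rewrite mulrCA.
Qed.

HB.instance Definition _ (R : realType) (G : finZmodType) (u : G -> G -> R) :=
  GRing.isLinear.Build R {ffun G -> R} {ffun G -> R} _ (energy_kernel u)
    (energy_kernel_is_linear u).

(* Main.v *)
(* Write x = 1/2 + y with y orthogonal to the constants. The energy kernel is
   diagonalised by the characters of G, so it suffices that its eigenvalue at
   the checkerboard character (-1)^(j_1 + ... + j_d) is strictly smaller than
   all the others. For the kernel q^delta(g,h), 0 < q < 1, the eigenvalues are
   products over the coordinates of
     (1 - q^2)(1 - z^m q^m) / (1 - 2 q Re z + q^2),   z^(2m) = 1, n_i = 2m,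
   and since m is even (or n_i = 2) each factor is smallest exactly at z = -1.
   A completely monotonic f is a positive mixture of the functions q^t; instead
   of Bernstein's theorem, we use that the functional X^i |-> f(i+1) is positive
   on polynomials that are nonnegative on ]0, 1[, which follows from Bernstein
   polynomial expansions since the finite differences (-1)^m Delta^m f are
   positive. For E_max, note that E_tot(S) <= |S| E_max(S), with equality for
   the checkerboards by translation invariance. *)
Require Import Defs.
From HB Require Import structures.
From mathcomp Require Import all_boot all_order all_algebra.
From mathcomp Require Import all_classical all_reals all_analysis.
From mathcomp Require Import complex separable cyclic cyclotomic ring lra zify.
Set Implicit Arguments.
Unset Strict Implicit.
Unset Printing Implicit Defensive.
Import Order.TTheory GRing.Theory Num.Theory.
Import numFieldNormedType.Exports.
Local Open Scope ring_scope.

(** * Positivity of moments of completely monotonic sequences *)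

Section CompletelyMonotonicSequences.
Variable R : archiRealFieldType.
Implicit Types (a : nat -> R) (p : {poly R}).

(** Minus the forward difference, so that [iter m bdiff a] is (-1)^m Delta^m a and Hausdorff's
    condition becomes plain positivity. *)
Definition bdiff a : nat -> R := fun i => a i - a i.+1.

Definition cm_seq a := forall m i, 0 < iter m bdiff a i.

(** If [a] is the moment sequence of a measure on [0, 1], this is the integral of [p]; no measure is
    ever constructed. *)
Definition moment a p : R := \sum_(i < size p) p`_i * a i.

Lemma moment_wide a p n :
  (size p <= n)%N -> moment a p = \sum_(i < n) p`_i * a i.
Proof.
move=> pn; rewrite /moment (big_ord_widen _ (fun i => p`_i * a i) pn).
rewrite big_mkcond; apply: eq_bigr => i _ /=.
by case: ltnP => // /leq_sizeP ->//; rewrite mul0r.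
Qed.

Fact moment_is_linear a : linear_for *%R (moment a).
Proof.
move=> c p q /=; pose n := maxn (size p) (size q).
have szn : (size (c *: p + q)%R <= n)%N.
  rewrite (leq_trans (size_polyD _ _))// /n geq_max leq_maxr andbT.
  by rewrite (leq_trans (size_scale_leq _ _))// leq_maxl.
rewrite (moment_wide _ szn) (@moment_wide a p n) ?leq_maxl//.
rewrite (@moment_wide a q n) ?leq_maxr// mulr_sumr -big_split/=.
by apply: eq_bigr => i _; rewrite coefD coefZ mulrDl mulrA.
Qed.

HB.instance Definition _ a :=
  GRing.isLinear.Build R {poly R} R _ (moment a) (moment_is_linear a).

Lemma moment_mul1BX a p : moment a (p * (1 - 'X)) = moment (bdiff a) p.
Proof.
rewrite mulrBr mulr1 linearB/=.
have szX : (size (p * 'X)%R <= (size p).+1)%N.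
  by rewrite (leq_trans (size_polyMleq _ _))// size_polyX addn2.
rewrite (moment_wide _ szX) big_ord_recl coefMX eqxx mul0r add0r.
rewrite /moment -sumrB; apply: eq_bigr => i _.
by rewrite coefMX /= /bump/= add1n mulrBr.
Qed.

(** For a [cm_seq] this makes the moments of Bernstein polynomials positive; the case [m = 0]
    recovers the sequence itself. *)
Lemma moment_XnM1BXn a i m :
  moment a ('X^i * (1 - 'X) ^+ m) = iter m bdiff a i.
Proof.
elim: m a => [|m IH] a.
  rewrite mulr1 /moment size_polyXn big_ord_recr big1 /= => [|j _].
    by rewrite coefXn eqxx mul1r add0r.
  by rewrite coefXn ltn_eqF ?mul0r.
by rewrite exprSr mulrA moment_mul1BX IH iterSr.
Qed.

(** The quotient of binomials C(i, k) / C(N, k), which for k <= N is the i-th Bernstein coefficient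
    of 'X^k in degree [N]. *)
Definition bern_coef (k N i : nat) : R :=
  \prod_(j < k) ((i%:R - j%:R) / (N%:R - j%:R)).

(** Induction on [k] through (N-k) C(N-k-1, i-k-1) = (i-k) C(N-k, i-k); once [k] exceeds [i], the
    product contains the factor i - i. *)
Lemma bern_coefM_bin (k N i : nat) : (k <= N)%N -> (i <= N)%N ->
  bern_coef k N i * 'C(N, i)%:R = if (k <= i)%N then 'C(N - k, i - k)%:R else 0.
Proof.
move=> + iN; elim: k => [|k IH] kN.
  by rewrite /bern_coef big_ord0 mul1r !subn0.
rewrite /bern_coef big_ord_recr/= -/(bern_coef k N i) mulrAC IH ?(ltnW kN)//.
case: ltngtP => [ki|ik|<-]; last 2 first.
- by rewrite mul0r.
- by rewrite subrr mul0r mulr0.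
have Nk : (N%:R - k%:R : R) != 0 by rewrite subr_eq0 eqr_nat gtn_eqF.
apply: (mulIf Nk); rewrite mulrA mulfVK//.
rewrite -!natrB ?(ltnW ki) ?(ltnW kN)// -!natrM.
have -> : (N - k = (N - k.+1).+1)%N by lia.
have -> : (i - k = (i - k.+1).+1)%N by lia.
by rewrite mulnC -mul_bin_diag mulnC.
Qed.

(** Multiply 'X^k by ((1 - 'X) + 'X)^(N-k) = 1 and expand; the indices below [k] carry zero
    coefficients. *)
Lemma polyXn_bern (k N : nat) : (k <= N)%N ->
  'X^k = \sum_(i < N.+1)
    (bern_coef k N i * 'C(N, i)%:R) *: ('X^i * (1 - 'X) ^+ (N - i)) :> {poly R}.
Proof.
move=> kN; have {1}-> : 'X^k = 'X^k * (1 - 'X + 'X) ^+ (N - k) :> {poly R}.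
  by rewrite subrK expr1n mulr1.
rewrite exprDn mulr_sumr.
rewrite -(big_mkord xpredT (fun i => (bern_coef k N i * 'C(N, i)%:R) *:
  ('X^i * (1 - 'X) ^+ (N - i)) : {poly R})).
rewrite (big_cat_nat (n := k)) //=; last exact: leqW.
rewrite [X in _ = X + _]big_nat [X in _ = X + _]big1 ?add0r; last first.
  move=> i /andP[_ ik]; rewrite bern_coefM_bin//; last exact: leq_trans (ltnW ik) kN.
  by rewrite leqNgt ik scale0r.
rewrite -[X in \sum_(X <= i < _) _]add0n big_addn subSn// big_mkord.
apply: eq_bigr => -[i/= ilt] _.
rewrite bern_coefM_bin ?leq_addl// ?addnK; last lia.
rewrite scaler_nat mulrnAr; congr (_ *+ _).
rewrite addnC exprD subnDA -mulrA; congr (_ * _).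
by rewrite mulrC.
Qed.

(* The nodes (i+1)/(N+2) replace the usual i/N so as to stay inside the open
   unit interval. *)
Lemma bern_coef_near (D k N i : nat) :
    (k <= D)%N -> (D.*2 < N)%N -> (i <= N)%N ->
  `|bern_coef k N i - (i.+1%:R / N.+2%:R) ^+ k| <= k%:R * (D%:R / (N - D)%:R).
Proof.
move=> kD DN iN; set t := _ / _.
have t01 : 0 <= t <= 1.
  rewrite /t divr_ge0//= ler_pdivrMr ?ltr0n// mul1r ler_nat; lia.
elim: k kD => [|k IH] kD; first by rewrite /bern_coef big_ord0 subrr normr0 mul0r.
rewrite /bern_coef big_ord_recr/= -/(bern_coef k N i) exprSr.
set b := bern_coef k N i in IH *; set x := (i%:R - k%:R) / _.
have Nk : 0 < N%:R - k%:R :> R by rewrite subr_gt0 ltr_nat; lia.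
have kR : k%:R + 1 <= D%:R :> R by rewrite natr1 ler_nat.
have iR : i%:R <= N%:R :> R by rewrite ler_nat.
have NR : D%:R * 2 + 1 <= N%:R :> R.
  by rewrite -natrM natr1 ler_nat; lia.
have i0 : 0 <= i%:R :> R by [].
have k0 : 0 <= k%:R :> R by [].
have ND : (0 : R) < (N - D)%:R by rewrite ltr0n; lia.
have x1 : `|x| <= 1.
  rewrite /x normrM normfV (gtr0_norm Nk) ler_pdivrMr// mul1r ler_norml.
  by apply/andP; split; lra.
have xt : `|x - t| <= D%:R / (N - D)%:R.
  have -> : x - t = (i%:R * 2 - N%:R - k%:R * (N%:R + 1 - i%:R)) / N.+2%:R /
      (N%:R - k%:R).
    rewrite /x /t -!natr1; field.
    by rewrite gt_eqF//= gt_eqF//; lra.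
  rewrite normrM normfV (gtr0_norm Nk) ler_pM ?invr_ge0 ?(ltW Nk)//.
    by rewrite normrM normfV (ger0_norm (ler0n _ _)) ler_pdivrMr ?ltr0n// ler_norml;
       rewrite -!natr1; apply/andP; split; nra.
  rewrite lef_pV2 ?posrE// natrB; last lia.
  lra.
(* Each further factor adds at most |x - t| to the error, since |x| and t^k are at most 1; hence the
   factor [k%:R] in the bound. *)
have -> : b * x - t ^+ k * t = (b - t ^+ k) * x + t ^+ k * (x - t) by ring.
rewrite (le_trans (ler_normD _ _))// -natr1 [leRHS]mulrDl mul1r lerD//.
  rewrite normrM -[leRHS]mulr1 ler_pM//; exact: IH (ltnW kD).
rewrite normrM -[leRHS]mul1r ler_pM// ger0_norm ?exprn_ge0//; [|lra..].
by rewrite exprn_ile1//; lra.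
Qed.

(* The Bernstein coefficients of p of degree N are nonnegative up to O(1/N), and
   each Bernstein polynomial has a positive moment. *)
Lemma moment_ge0 a p : cm_seq a ->
  (forall q, 0 < q < 1 -> 0 <= p.[q]) -> 0 <= moment a p.
Proof.
move=> cma p0; have [D pD] : {D | (size p < D)%N} by exists (size p).+1.
pose M := \sum_(k < size p) `|p`_k|.
have a0 : 0 < a 0%N := cma 0%N 0%N.
have M0 : 0 <= M by apply: sumr_ge0.
(* Scaled by [N - D], the O(1/N) error becomes a bound free of [N], which a negative moment would
   violate for large [N]. *)
have key (N : nat) : (D.*2 < N)%N ->
    - (M * D%:R ^+ 2 * a 0%N) <= moment a p * (N - D)%:R.
  move=> DN; have ND : (0 : R) < (N - D)%:R by rewrite ltr0n; lia.
  pose beta (i : nat) := 'C(N, i)%:R * iter (N - i) bdiff a i.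
  have beta0 i : 0 <= beta i by rewrite /beta mulr_ge0// ltW.
  have LX (k : nat) : (k <= N)%N -> a k = \sum_(i < N.+1) bern_coef k N i * beta i.
    move=> kN; rewrite -[LHS](moment_XnM1BXn a k 0) mulr1 (polyXn_bern kN).
    rewrite linear_sum/=; apply: eq_bigr => i _.
    by rewrite linearZ/= moment_XnM1BXn mulrA.
  (* The weights [beta i] have total mass [a 0], so a uniform error in the Bernstein coefficients of
     [p] is multiplied by [a 0] only. *)
  have beta1 : \sum_(i < N.+1) beta i = a 0%N.
    rewrite (LX 0)//; apply: eq_bigr => i _.
    by rewrite /bern_coef big_ord0 mul1r.
  have -> : moment a p =
      \sum_(i < N.+1) beta i * \sum_(k < size p) p`_k * bern_coef k N i.
    transitivity (\sum_(k < size p) \sum_(i < N.+1)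
        beta i * (p`_k * bern_coef k N i)).
      apply: eq_bigr => -[k/= klt] _; have kD := ltn_trans klt pD; rewrite LX; last lia.
      by rewrite mulr_sumr; apply: eq_bigr => i _; rewrite mulrA mulrC.
    by rewrite exchange_big/=; apply: eq_bigr => i _; rewrite mulr_sumr.
  rewrite -ler_pdivrMr// -beta1.
  rewrite (_ : _ / _ =
      \sum_(i < N.+1) beta i * - (M * D%:R ^+ 2 / (N - D)%:R)); last first.
    by rewrite -mulr_suml; ring.
  rewrite ler_sum// => -[i/= ilt] _.
  rewrite ler_wpM2l//.
  pose t : R := i.+1%:R / N.+2%:R.
  have pt : 0 <= p.[t].
    apply: p0; rewrite /t divr_gt0 ?ltr0n//= ltr_pdivrMr ?ltr0n// mul1r ltr_nat; lia.
  rewrite -subr_ge0; apply: (le_trans pt); rewrite -subr_ge0.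
  rewrite horner_coef opprK addrAC -sumrB.
  rewrite (_ : _ + _ = M * (D%:R * (D%:R / (N - D)%:R)) -
      \sum_(k < size p) p`_k * (t ^+ k - bern_coef k N i)); last first.
    rewrite addrC; congr (_ + _); first by ring.
    by rewrite -sumrN; apply: eq_bigr => k _; ring.
  rewrite subr_ge0 (le_trans (ler_norm _))// (le_trans (ler_norm_sum _ _ _))//.
  rewrite /M mulr_suml ler_sum// => -[k/= klt] _.
  have kD := ltn_trans klt pD.
  rewrite normrM ler_wpM2l// distrC.
  apply: (le_trans (@bern_coef_near D k N i _ DN _)) => //.
    lia.
  rewrite ler_wpM2r ?divr_ge0// ler_nat; lia.
rewrite leNgt; apply/negP => Lneg.
(* Any [N] for which [N - D] exceeds this threshold contradicts [key]. *)
pose B := M * D%:R ^+ 2 * a 0%N / - moment a p.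
have B0 : 0 <= B by rewrite /B divr_ge0 ?mulr_ge0 ?exprn_ge0// ?ltW// oppr_gt0.
have := key (Num.bound B + D.*2 + D).+1 ltac:(lia).
have Bb : B < ((Num.bound B + D.*2 + D).+1 - D)%:R.
  apply: (lt_le_trans (archi_boundP B0)); rewrite ler_nat; lia.
move: Bb; rewrite /B ltr_pdivrMr ?oppr_gt0//.
lra.
Qed.

(** [moment_ge0] gives a weak inequality only. It is applied after subtracting [c *: (1 - 'X) ^+ b],
    whose moment is [c] times the positive difference [iter b bdiff a 0]. *)
Lemma moment_gt0 a p (c : R) (b : nat) : cm_seq a -> 0 < c ->
  (forall q, 0 < q < 1 -> c * (1 - q) ^+ b <= p.[q]) -> 0 < moment a p.
Proof.
move=> cma c0 cp.
have -> : moment a p = c * iter b bdiff a 0%N + moment a (p - c *: (1 - 'X) ^+ b).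
  by rewrite -moment_XnM1BXn expr0 mul1r linearB linearZ/=; ring.
rewrite ltr_wpDr ?mulr_gt0//; apply: moment_ge0 => // q q01.
by rewrite !hornerE subr_ge0 cp.
Qed.

End CompletelyMonotonicSequences.

(** * Finite differences of completely monotonic functions *)

Section CompletelyMonotonicFunctions.
Variable R : realType.

(** Arbitrary towers of derivatives let the induction on [m] run: the functions F k x - F k (x + 1)
    form such a tower again, and by the mean value theorem each equals -F k.+1 c, which has the
    required sign. *)
Lemma derive_tower_bdiff_gt0 (m : nat) (F : nat -> R -> R) (i : nat) :
    (forall k (x : R), 0 < x -> is_derive x 1 (F k) (F k.+1 x)) ->
    (forall k (x : R), 0 < x -> 0 < (-1) ^+ k * F k x) ->
  0 < iter m (@bdiff R) (fun j => F 0 j.+1%:R) i.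
Proof.
elim: m F => [|m IH] F dF F0.
  by have := F0 0%N i.+1%:R (ltr0Sn _ _); rewrite mul1r.
pose G k x := F k x - F k (x + 1).
rewrite iterSr (_ : bdiff _ = fun j => G 0%N j.+1%:R); last first.
  by apply/funext => j; rewrite /bdiff /G natr1.
apply: IH => k x x0.
  have x10 : 0 < x + 1 by rewrite addr_gt0.
  have dx := dF k x x0; have dx1 := dF k (x + 1) x10.
  have dshift : is_derive x 1 (fun y : R => y + 1) 1.
    have : is_derive x 1 (id + cst 1 : R -> R) (1 + 0) by apply: is_deriveD.
    by rewrite addr0.
  have := @is_derive1_comp R (F k) (fun y => y + 1) _ _ _ dx1 dshift; rewrite mulr1 => dc.
  exact: is_deriveB.
have [c cI ->] : exists2 c, c \in `]x, (x + 1)[ & G k x = - F k.+1 c.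
  have [|y yI||c cI e] := @MVT R (F k) (F k.+1) x (x + 1).
  - by rewrite ltrDl.
  - by apply: dF; move: yI; rewrite in_itv/= => /andP[/(lt_trans x0)].
  - apply: continuous_in_subspaceT => y; rewrite inE/= in_itv/= => /andP[xy _].
    have /@ex_derive /derivable1_diffP := dF k y (lt_le_trans x0 xy).
    exact: differentiable_continuous.
  - by exists c => //; rewrite /G -opprB e addrAC subrr add0r mulr1.
move: cI; rewrite in_itv/= => /andP[/(lt_trans x0) c0 _].
by have := F0 k.+1 c c0; rewrite exprS mulN1r mulNr mulrN.
Qed.

(** Sampling starts at 1 because [f] is controlled on the open half-line only. *)
Lemma completely_monotonic_cm_seq (f : R -> R) :
  completely_monotonic f -> cm_seq (fun i => f i.+1%:R).
Proof.
move=> cmf m i; apply: (@derive_tower_bdiff_gt0 m (fun k => derive1n k f)).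
  move=> k x x0; have [dk _] := cmf k x x0.
  by rewrite derive1nS derive1E; apply: DeriveDef.
by move=> k x x0; have [] := cmf k x x0.
Qed.

End CompletelyMonotonicFunctions.

(** * Eigenvalues of a cycle *)

(** For [j < n], the distance from [j] to 0 on the cycle of length [n]. *)
Definition cyc_weight (n j : nat) : nat := minn j (n - j).

(** The two halves of the cycle are geometric series, in [q * z] and, read backwards, in [q * w]
    with [w] the inverse of [z]. The second covers the distances 1 to [m], whence its extra factor
    [q * w]; the end terms agree because w^m = z^m. *)
Lemma sum_cyc_weight (K : comPzRingType) (m : nat) (q z w : K) :
    z * w = 1 -> z ^+ m.*2 = 1 ->
  (\sum_(j < m.*2) q ^+ cyc_weight m.*2 j * z ^+ j) * ((1 - q * z) * (1 - q * w))
    = (1 - q ^+ 2) * (1 - z ^+ m * q ^+ m).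
Proof.
move=> zw z2m.
have geom (x : K) : (\sum_(j < m) x ^+ j) * (1 - x) = 1 - x ^+ m.
  by rewrite -opprB mulrN mulrC -subrX1 opprB.
have wm : w ^+ m = z ^+ m.
  by rewrite -[LHS]mul1r -z2m -addnn exprD -mulrA -exprMn zw expr1n mulr1.
have -> : \sum_(j < m.*2) q ^+ cyc_weight m.*2 j * z ^+ j =
    \sum_(j < m) (q * z) ^+ j + (\sum_(j < m) (q * w) ^+ j) * (q * w).
  rewrite -(big_mkord xpredT (fun j => q ^+ cyc_weight m.*2 j * z ^+ j)).
  rewrite (big_cat_nat (n := m)) ?leq0n -?addnn ?leq_addr//=; congr (_ + _).
    rewrite big_mkord; apply: eq_bigr => -[j/= jm] _.
    by rewrite exprMn /cyc_weight (minn_idPl _)//; lia.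
  rewrite -{1}[m]add0n big_addn addnK big_mkord mulr_suml.
  rewrite (reindex_inj rev_ord_inj); apply: eq_bigr => -[j/= jm] _.
  rewrite -exprSr exprMn /cyc_weight (minn_idPr _); last lia.
  have -> : (m + m - (m - j.+1 + m) = j.+1)%N by lia.
  congr (_ * _); rewrite -[RHS]mul1r -z2m -addnn.
  have -> : (m + m = (m - j.+1 + m) + j.+1)%N by lia.
  by rewrite [in RHS]exprD -[RHS]mulrA -exprMn zw expr1n mulr1.
have := geom (q * z); have := geom (q * w); rewrite !exprMn wm.
set X := \sum_(_ < _) _; set Y := \sum_(_ < _) _ => hX hY.
transitivity (Y * (1 - q * z) * (1 - q * w) + X * (1 - q * w) * (1 - q * z) * (q * w)).
  by ring.
rewrite hX hY; have -> : q ^+ 2 = q ^+ 2 * (z * w) by rewrite zw mulr1.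
ring.
Qed.

Section CoordinateEigenvalues.
Variable R : realType.

(* Here c = Re z and e = z^m for a (2m)-th root of unity z, see cyc_eigE. *)
Definition cyc_eig (m : nat) (c e q : R) : R :=
  (1 - q ^+ 2) * (1 - e * q ^+ m) / (1 - q * c *+ 2 + q ^+ 2).

(** On the unit circle the inverse of [z] is its conjugate, so the denominator in [sum_cyc_weight]
    is real; it equals (1 - q)^2 + 2q(1 - Re z) > 0. *)
Lemma cyc_eigE (m : nat) (q e : R) (z : R[i]) : 0 < q < 1 ->
    `|z| = 1 -> z ^+ m.*2 = 1 -> z ^+ m = (real_complex R e) ->
  \sum_(j < m.*2) (real_complex R q) ^+ cyc_weight m.*2 j * z ^+ j =
    real_complex R (cyc_eig m (complex.Re z) e q).
Proof.
case: z => a b q01 nz z2m zm.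
have ab : a ^+ 2 + b ^+ 2 = 1.
  by apply: complexI; rewrite (add_Re2_Im2 (Complex a b)) nz expr1n.
pose w : R[i] := Complex a (- b).
have zw : Complex a b * w = 1.
  by apply/eqP; rewrite eq_complex/=; apply/andP; split; apply/eqP; [rewrite -ab|]; ring.
have a1 : a <= 1.
  by have := sqr_ge0 b => b0; rewrite leNgt; apply/negP => a1; nra.
have D0 : 0 < 1 - q * a *+ 2 + q ^+ 2.
  have : 0 < (1 - q) ^+ 2 by rewrite exprn_gt0//; lra.
  have : 0 <= q * (1 - a) by rewrite mulr_ge0//; lra.
  lra.
apply: (mulIf (x := real_complex R (1 - q * a *+ 2 + q ^+ 2))).
  by rewrite -(rmorph0 (real_complex R)) (inj_eq (@complexI R)) gt_eqF.
rewrite -rmorphM /cyc_eig divfK ?gt_eqF//=.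
have -> : real_complex R (1 - q * a *+ 2 + q ^+ 2) =
    (1 - real_complex R q * Complex a b) * (1 - real_complex R q * w).
  apply/eqP; rewrite eq_complex/=; apply/andP; split; apply/eqP; last by ring.
  have {1}-> : q ^+ 2 = q ^+ 2 * (a ^+ 2 + b ^+ 2) by rewrite ab mulr1.
  ring.
apply: etrans (sum_cyc_weight _ zw z2m) _.
by rewrite zm !(rmorphM, rmorphB, rmorphXn, rmorph1).
Qed.

(** The numerator is least at e = 1 and the denominator D greatest at c = -1. With P the numerator
    at e = 1, the gap is at least 2(1 + c)qP / (D(1 + q)^2); P >= (1 - q)^2 and both denominators
    being at most 4 give the constant 1/8. *)
Lemma cyc_eig_ineq_even (m : nat) (c e q : R) : (1 < m)%N ->
    -1 <= c <= 1 -> e = 1 \/ e = -1 -> 0 < q < 1 ->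
  (1 - q) ^+ 2 / 2 <= cyc_eig m (-1) 1 q /\
  cyc_eig m (-1) 1 q + (1 + c) / 8 * (q * (1 - q) ^+ 2) <= cyc_eig m c e q.
Proof.
move=> m1 c1 e1 q01.
have X0 : 0 < q ^+ m by rewrite exprn_gt0//; lra.
have Xq : q ^+ m <= q.
  by rewrite -[leRHS]expr1 ler_wiXn2l//; [lra..|exact: ltnW].
rewrite /cyc_eig; set X := q ^+ m in X0 Xq *.
set D := 1 - q * c *+ 2 + _; have -> : 1 - q * -1 *+ 2 + q ^+ 2 = (1 + q) ^+ 2 by ring.
have qq : 0 < (1 - q) ^+ 2 by rewrite exprn_gt0//; lra.
have qc : 0 <= q * (1 - c) by rewrite mulr_ge0//; lra.
have qc' : 0 <= q * (1 + c) by rewrite mulr_ge0//; lra.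
have q2 : q ^+ 2 <= q by rewrite expr2 -[leRHS]mul1r ler_wpM2r//; lra.
have D0 : 0 < D <= 4 by rewrite /D; lra.
have E0 : 0 < (1 + q) ^+ 2 <= 4 by have := sqr_ge0 q; lra.
set P := (1 - q ^+ 2) * (1 - 1 * X).
have P0 : (1 - q) ^+ 2 <= P by rewrite /P; nra.
have q0 : 0 <= (1 - q) ^+ 2 by rewrite exprn_ge0//; lra.
split.
  rewrite ler_pdivlMr; last lra.
  have : (1 - q) * (1 - q) * (1 + q) <= P by rewrite /P; nra.
  have : 0 <= (1 - q) ^+ 2 * (1 + q) * (1 - q) by rewrite !mulr_ge0//; lra.
  nra.
have aP : P / D <= (1 - q ^+ 2) * (1 - e * X) / D.
  rewrite ler_pM2r ?invr_gt0; last lra.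
  by rewrite /P ler_wpM2l//; [nra|case: e1 => ->; lra].
apply: le_trans aP.
have -> : P / D = P / (1 + q) ^+ 2 + (1 + c) * q * 2 * P / (D * (1 + q) ^+ 2).
  have := @gt_eqF _ R; rewrite /D => gtF.
  by field; rewrite !gtF//; lra.
rewrite lerD2l ler_pdivlMr; last by rewrite mulr_gt0//; lra.
have DE : D * (1 + q) ^+ 2 <= 4 * 4 by rewrite ler_pM//; lra.
have cq : 0 <= (1 + c) * q by rewrite mulr_ge0//; lra.
have : (1 + c) * q * (1 - q) ^+ 2 * (D * (1 + q) ^+ 2) <= (1 + c) * q * P * (4 * 4).
  apply: ler_pM => //; [by rewrite mulr_ge0|by rewrite mulr_ge0//; lra|].
  by rewrite ler_wpM2l.
lra.
Qed.

(** A coordinate of order 2 has z = z^m = c, and the factor collapses to 1 - q at c = -1 and to 1 +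
    q at c = 1. *)
Lemma cyc_eig_ineq1 (c q : R) : c = 1 \/ c = -1 -> 0 < q < 1 ->
  (1 - q) ^+ 2 / 2 <= cyc_eig 1 (-1) (-1) q /\
  cyc_eig 1 (-1) (-1) q + (1 + c) / 8 * (q * (1 - q) ^+ 2) <= cyc_eig 1 c c q.
Proof.
move=> c1 q01.
have -> : cyc_eig 1 (-1) (-1) q = 1 - q.
  rewrite /cyc_eig expr1; have -> : 1 - q * -1 *+ 2 + q ^+ 2 = (1 + q) ^+ 2 by ring.
  by field; rewrite gt_eqF//; lra.
split; first nra.
case: c1 => ->; last first.
  rewrite /cyc_eig expr1; have -> : 1 - q * -1 *+ 2 + q ^+ 2 = (1 + q) ^+ 2 by ring.
  rewrite subrr !mul0r addr0 ler_pdivlMr; nra.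
rewrite /cyc_eig expr1; have -> : 1 - q * 1 *+ 2 + q ^+ 2 = (1 - q) ^+ 2 by ring.
have -> : (1 - q ^+ 2) * (1 - 1 * q) / (1 - q) ^+ 2 = 1 + q.
  by field; rewrite gt_eqF//; lra.
have : 0 <= q * (1 - (1 - q) ^+ 2) by rewrite mulr_ge0//; nra.
lra.
Qed.
End CoordinateEigenvalues.

(** * The Lee distance *)

(** Through the bijection with [fprod], whose tagged indices reduce the dependent family to
    distributivity over a single index type. *)
Lemma bigA_distr_dffun (K : comPzSemiRingType) (I : finType) (T : I -> finType)
    (F : forall i, T i -> K) :
  \prod_i \sum_(j : T i) F i j = \sum_(g : {dffun forall i, T i}) \prod_i F i (g i).
Proof.
rewrite (reindex (@dffun_of_fprod I T)); last first.
  exact/onW_bij/dffun_of_fprod_bij.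
pose P i := [ffun j => F i j].
transitivity (\sum_(t : fprod T) \prod_(i in I) P i (t i)); last first.
  by apply: eq_bigr => t _; apply: eq_bigr => i _; rewrite !ffunE.
rewrite big_fprod.
rewrite -(bigA_distr_big_dep (fun i => tagged_with T i) (fun i => untag 0 (P i))).
apply: eq_bigr => i _; rewrite -(big_tag (fun i => P i)).
by apply: eq_bigr => j _; rewrite ffunE.
Qed.

Lemma cyc_weight_Zp0 (n : nat) : cyc_weight n (0%R : 'Z_n) = 0%N.
Proof. by rewrite /cyc_weight min0n. Qed.

Lemma val_ZpD (n : nat) (a b : 'Z_n) : (1 < n)%N ->
  ((a + b)%R : 'Z_n) = ((a + b) %% n)%N :> nat.
Proof. by move=> n1 /=; congr (_ %% _)%N; exact: Zp_cast. Qed.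

Lemma val_Zp1 (n : nat) : (1 < n)%N -> (1%R : 'Z_n) = 1%N :> nat.
Proof. by []. Qed.

Lemma val_ZpN1 (n : nat) : (1 < n)%N -> ((- 1)%R : 'Z_n) = n.-1 :> nat.
Proof.
by move=> n1 /=; rewrite Zp_cast// (modn_small n1) subn1 modn_small ?prednK// ltnW.
Qed.

Section LeeDistance.
Variables (d : nat) (n : 'I_d -> nat).
Hypothesis n_gt1 : forall i, (1 < n i)%N.
Local Notation G := (lee_group n).
Implicit Types g h x y : G.

Definition lee_weight g : nat := \sum_i cyc_weight (n i) (g i).

Lemma lee_weight0 : lee_weight 0 = 0%N.
Proof. by apply: big1 => i _; rewrite ffunE cyc_weight_Zp0. Qed.

Lemma lt_Zp_val i (a : 'Z_(n i)) : (a < n i)%N.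
Proof. by rewrite -[ltnRHS](Zp_cast (n_gt1 i)) ltn_ord. Qed.

Lemma cyc_weight_addP i (a : 'Z_(n i)) :
  (cyc_weight (n i) a <= (cyc_weight (n i) (a + 1)%R).+1)%N &&
  (cyc_weight (n i) (a + 1)%R <= (cyc_weight (n i) a).+1)%N.
Proof.
have := lt_Zp_val a; have n1 := n_gt1 i; rewrite val_ZpD// val_Zp1// => an.
have [e|ne] := eqVneq (a.+1) (n i).
  by rewrite addn1 e modnn /cyc_weight; lia.
rewrite modn_small addn1 /cyc_weight; lia.
Qed.

(** Step along the shorter arc to 0: down in the first half, up in the second, possibly wrapping
    around to 0. *)
Lemma cyc_weight_desc i (a : 'Z_(n i)) : a != 0 ->
  exists b : 'Z_(n i), (b = a + 1 \/ b = a - 1) /\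
    cyc_weight (n i) a = (cyc_weight (n i) b).+1.
Proof.
have := lt_Zp_val a; have n1 := n_gt1 i => an a0.
have a_gt0 : (0 < a)%N by rewrite lt0n; apply: contraNneq a0 => a0; apply/eqP/val_inj.
have [le|gt] := leqP a (n i - a).
  exists (a - 1); split; first by right.
  have -> : (a - 1 : 'Z_(n i)) = a.-1 :> nat.
    rewrite val_ZpD// val_ZpN1//.
    have -> : (a + (n i).-1 = a.-1 + n i)%N by lia.
    by rewrite modnDr modn_small//; lia.
  by rewrite /cyc_weight; lia.
exists (a + 1); split; first by left.
have [e|ne] := eqVneq (a.+1) (n i).
  have -> : (a + 1 : 'Z_(n i)) = 0%N :> nat.
    by rewrite val_ZpD// val_Zp1// addn1 e modnn.
  by rewrite /cyc_weight; lia.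
have -> : (a + 1 : 'Z_(n i)) = a.+1 :> nat.
  by rewrite val_ZpD// val_Zp1// addn1 modn_small//; lia.
by rewrite /cyc_weight; lia.
Qed.

Lemma lee_weight_off i g h : (forall j, j != i -> g j = h j) ->
  (lee_weight g + cyc_weight (n i) (h i) = lee_weight h + cyc_weight (n i) (g i))%N.
Proof.
move=> gh; rewrite /lee_weight (bigD1 i)//= [in RHS](bigD1 i)//=.
by rewrite (eq_bigr (fun j => cyc_weight (n j) (h j))) => [|j /gh ->//]; lia.
Qed.

Lemma lee_unit_diag i : lee_unit n i i = 1.
Proof. by rewrite ffunE eqxx. Qed.

Lemma lee_weight_unit i g : 
  (lee_weight g <= (lee_weight (g + lee_unit n i)%R).+1)%N &&
  (lee_weight (g + lee_unit n i)%R <= (lee_weight g).+1)%N.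
Proof.
have := @lee_weight_off i g (g + lee_unit n i).
have := cyc_weight_addP (g i); rewrite [(g + _) i]ffunE lee_unit_diag.
move=> /andP[h1 h2] /(_ _)/wrap[j ji|]; last lia.
by rewrite !ffunE (negPf ji) addr0.
Qed.

Lemma lee_adj_weight x y z : lee_adj x y ->
  (lee_weight (x - z)%R <= (lee_weight (y - z)%R).+1)%N.
Proof.
move=> /existsP[i /orP[]/eqP e].
  have /andP[] := lee_weight_unit i (x - z).
  by rewrite -e addrAC subrKC.
have /andP[_] := lee_weight_unit i (y - z).
by rewrite -[lee_unit n i]opprK -e opprB addrAC subrKC.
Qed.

(** Lower bound for the distance: an edge lowers the weight relative to [z] by at most one. *)
Lemma lee_path_weight x p z : path (@lee_adj d n) x p ->
  (lee_weight (x - z)%R <= lee_weight (last x p - z)%R + size p)%N.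
Proof.
elim: p x => [|y p IH] x /=; first by rewrite addn0.
by move=> /andP[/(lee_adj_weight z) xy /IH]; lia.
Qed.

(** Upper bound for the distance: induction on the weight, moving a nonzero coordinate of [x - y]
    along its shorter arc. *)
Lemma lee_weight_path x y : exists p,
  [/\ path (@lee_adj d n) x p, last x p = y & size p = lee_weight (x - y)].
Proof.
have [k] := ubnP (lee_weight (x - y)); elim: k x => // k IH x xk.
have [->|xy] := eqVneq x y; first by exists [::]; rewrite subrr lee_weight0.
have [i xyi] : exists i, (x - y) i != 0.
  apply/existsP; rewrite -negb_forall; apply: contra xy => /forallP e.
  by rewrite -subr_eq0; apply/eqP/ffunP => i; rewrite [RHS]ffunE; apply/eqP.
have [b [bE wb]] := cyc_weight_desc xyi.
have [s [sE si soff]] : exists s : G, [/\ s = lee_unit n i \/ s = - lee_unit n i,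
    b = (x - y) i + s i & forall j, j != i -> s j = 0].
  case: bE => bE; [exists (lee_unit n i)|exists (- lee_unit n i)]; split.
  - by left.
  - by rewrite bE lee_unit_diag.
  - by move=> j ji; rewrite ffunE (negPf ji).
  - by right.
  - by rewrite bE [(- lee_unit n i) i]ffunE lee_unit_diag.
  - by move=> j ji; rewrite !ffunE (negPf ji) oppr0.
have wE : lee_weight (x - y) = (lee_weight (x + s - y)).+1.
  have := @lee_weight_off i (x - y) (x + s - y).
  rewrite [x + s - y]addrAC [(x - y + s) i]ffunE -si wb.
  by move=> /(_ _)/wrap[j ji|]; [rewrite [RHS]ffunE soff// addr0|lia].
have [p [xp pl sp]] := IH (x + s) ltac:(lia).
exists (x + s :: p); split => //=; last by rewrite sp wE.
rewrite xp andbT; apply/existsP; exists i.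
by rewrite addrC addKr; case: sE => ->; rewrite eqxx ?orbT.
Qed.

Lemma lee_distE x y : lee_dist x y = lee_weight (x - y).
Proof.
have [p [xp pl sp]] := lee_weight_path x y.
apply/eqP; rewrite eqn_leq; apply/andP; split.
  by rewrite -sp -pl; apply: graph_dist_le.
have : connect (@lee_adj d n) x y by apply/connectP; exists p.
move=> /graph_dist_path[q [xq ql sq]].
by have := lee_path_weight y xq; rewrite ql subrr lee_weight0 sq.
Qed.
End LeeDistance.

(** * Fourier analysis on the Lee group *)

(** 'X^n - 1 splits and is separable in characteristic 0, so there are n distinct n-th roots of
    unity, and one of them is primitive. *)
Lemma closed_prim_root_exists (K : numClosedFieldType) (n : nat) :
  (0 < n)%N -> exists z : K, n.-primitive_root z.
Proof.
move=> n0; have [r] := closed_field_poly_normal ('X^n - 1 : {poly K}).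
rewrite (monicP (monicXnsubC 1 n0)) scale1r => pr.
have rP z : (z \in r) = n.-unity_root z by rewrite -root_prod_XsubC -pr.
have szr : size r = n.
  by apply/eqP; rewrite -eqSS -(size_prod_XsubC r id) -pr size_XnsubC.
have ur : uniq r.
  by rewrite -separable_prod_XsubC -pr separable_Xn_sub_1// pnatr_eq0 -lt0n.
have /hasP[z _ zP] : has n.-primitive_root r; last by exists z.
by apply: has_prim_root => //; [apply/allP => z; rewrite rP|rewrite szr].
Qed.

Section ComplexRealPart.
Variable R : realType.
Implicit Types (r : R) (z : R[i]).
Local Notation "r %:C" := (real_complex R r).

Lemma complexReD z1 z2 : complex.Re (z1 + z2) = complex.Re z1 + complex.Re z2.
Proof. by case: z1 z2 => [? ?] [? ?]. Qed.

Lemma complexRe_sum (I : Type) (s : seq I) (P : pred I) (F : I -> R[i]) :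
  complex.Re (\sum_(i <- s | P i) F i) = \sum_(i <- s | P i) complex.Re (F i).
Proof. exact: (big_morph (@complex.Re R) complexReD). Qed.

Lemma complexReMl r z : complex.Re (r%:C * z) = r * complex.Re z.
Proof. by case: z => a b /=; rewrite mul0r subr0. Qed.

Lemma complexReMr r z : complex.Re (z * r%:C) = complex.Re z * r.
Proof. by rewrite mulrC complexReMl mulrC. Qed.

(** The squared modulus as an element of [R]; the norm on [R[i]] takes its values in [R[i]]. *)
Definition sqnormc z : R := complex.Re z ^+ 2 + complex.Im z ^+ 2.

Lemma sqnormc_ge0 z : 0 <= sqnormc z.
Proof. by rewrite addr_ge0 ?sqr_ge0. Qed.

Lemma sqnormc_eq0 z : sqnormc z = 0 -> z = 0.
Proof.
move=> /eqP; rewrite paddr_eq0 ?sqr_ge0// !sqrf_eq0 => /andP[a0 b0].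
by apply/eqP; rewrite eq_complex a0 b0.
Qed.

Lemma sqnormcE z : (sqnormc z)%:C = z * conjc z.
Proof.
case: z => a b; apply/eqP; rewrite eq_complex/= /sqnormc/=.
by apply/andP; split; apply/eqP; ring.
Qed.

End ComplexRealPart.

Section Characters.
Variables (R : realType) (d : nat) (n : 'I_d -> nat) (om : 'I_d -> R[i]).
Hypothesis n_gt1 : forall i, (1 < n i)%N.
Hypothesis om_prim : forall i, (n i).-primitive_root (om i).
Local Notation G := (lee_group n).
Local Notation "r %:C" := (real_complex R r).
Implicit Types (g h k : G) (x : {ffun G -> R}).

(** The primitive roots [om] identify the group with its dual, so characters are indexed by group
    elements. *)
Definition chr k g : R[i] := \prod_i om i ^+ (k i * g i).

Lemma chrC k g : chr k g = chr g k.
Proof. by apply: eq_bigr => i _; rewrite mulnC. Qed.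

Lemma chrD k g h : chr k (g + h) = chr k g * chr k h.
Proof.
rewrite -big_split; apply: eq_bigr => i _ /=.
rewrite -exprD -mulnDr ffunE val_ZpD//.
by apply/eqP; rewrite (eq_prim_root_expr (om_prim i)) modnMmr.
Qed.

Lemma chr0 k : chr k 0 = 1.
Proof. by apply: big1 => i _; rewrite ffunE muln0. Qed.

Lemma chrN k g : chr k (- g) = conjc (chr k g).
Proof.
have unit1 : chr k g * conjc (chr k g) = 1.
  rewrite rmorph_prod -big_split; apply: big1 => i _ /=.
  set z := om i ^+ _; have zn : z ^+ n i = 1.
    by rewrite exprAC (prim_expr_order (om_prim i)) expr1n.
  have nz : `|z| = 1.
    by apply/eqP; rewrite -(@pexpr_eq1 _ _ (n i)) ?(ltnW (n_gt1 i))// -normrX zn normr1.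
  by rewrite -sqnormcE /sqnormc add_Re2_Im2 nz expr1n.
have nz : chr k g != 0.
  by apply: contra_eq_neq unit1 => ->; rewrite mul0r eq_sym oner_eq0.
by apply: (mulfI nz); rewrite unit1 -chrD subrr chr0.
Qed.

(** If [g i] is nonzero, translating the summation index by [lee_unit n i] multiplies the sum by
    [om i ^+ g i], which is not 1. *)
Lemma sum_chr g : \sum_k chr k g = (#|{: G}| * (g == 0))%:R.
Proof.
have [->|g0] := eqVneq g 0.
  under eq_bigr do rewrite chr0.
  by rewrite sumr_const muln1.
have [i gi] : exists i, g i != 0.
  apply/existsP; rewrite -negb_forall; apply: contra g0 => /forallP e.
  by apply/eqP/ffunP => i; rewrite [RHS]ffunE; apply/eqP.
have S : \sum_k chr k g = chr (lee_unit n i) g * \sum_k chr k g.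
  rewrite {1}(reindex_inj (addrI (lee_unit n i))) mulr_sumr.
  by apply: eq_bigr => k _; rewrite ![chr _ g]chrC chrD.
have c1 : chr (lee_unit n i) g != 1.
  rewrite /chr (bigD1 i)//= big1 => [|j ji]; last first.
    by rewrite ffunE (negPf ji) mul0n.
  rewrite lee_unit_diag mulr1 val_Zp1// mul1n -[1](expr0 (om i)).
  rewrite (eq_prim_root_expr (om_prim i)) mod0n modn_small ?lt_Zp_val//.
rewrite muln0; apply/eqP; move/eqP: S; rewrite -subr_eq0 -{1}[X in X - _]mul1r -mulrBl.
by rewrite mulf_eq0 subr_eq0 eq_sym (negPf c1).
Qed.

Definition fourier x k : R[i] := \sum_g (x g)%:C * chr k g.

Lemma fourier_inv x g :
  \sum_k fourier x k * chr k (- g) = (#|{: G}|%:R * x g)%:C.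
Proof.
transitivity (\sum_h \sum_k (x h)%:C * chr k (h - g)).
  rewrite exchange_big; apply: eq_bigr => k _; rewrite mulr_suml.
  by apply: eq_bigr => h _; rewrite chrD mulrA.
rewrite (bigD1 g)//= [X in _ + X]big1 => [|h hg]; last first.
  by rewrite -mulr_sumr sum_chr subr_eq0 (negPf hg) muln0 mulr0.
rewrite addr0 -mulr_sumr sum_chr subrr eqxx muln1 mulrC rmorphM rmorph_nat //.
Qed.

Lemma fourier_convolution (a : G -> R) x k :
  fourier [ffun h => \sum_g a g * x (h - g)] k =
  (\sum_g (a g)%:C * chr k g) * fourier x k.
Proof.
transitivity (\sum_g \sum_h (a g)%:C * (x (h - g))%:C * chr k h).
  rewrite exchange_big; apply: eq_bigr => h _ /=.
  rewrite ffunE rmorph_sum mulr_suml; apply: eq_bigr => g _.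
  by rewrite rmorphM.
rewrite mulr_suml; apply: eq_bigr => g _.
rewrite (reindex_inj (addrI g)) mulr_sumr; apply: eq_bigr => h _ /=.
by rewrite [g + h - g]addrAC subrr add0r chrD mulrACA.
Qed.

(** Parseval's identity for [x] and its convolution with [a]. The right side is real, so real parts
    of the multipliers suffice. *)
Lemma fourier_quadratic (a : G -> R) x :
  \sum_k complex.Re (\sum_g (a g)%:C * chr k g) * sqnormc (fourier x k) =
  #|{: G}|%:R * \sum_h \sum_g a g * (x h * x (h - g)).
Proof.
pose c : {ffun G -> R} := [ffun h => \sum_g a g * x (h - g)].
have E : \sum_k (\sum_g (a g)%:C * chr k g) * (sqnormc (fourier x k))%:C =
    (#|{: G}|%:R * \sum_h \sum_g a g * (x h * x (h - g)))%:C.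
  transitivity (\sum_h (x h)%:C * \sum_k fourier c k * chr k (- h)).
    under [RHS]eq_bigr do rewrite mulr_sumr.
    rewrite exchange_big; apply: eq_bigr => k _.
    rewrite sqnormcE mulrA -fourier_convolution rmorph_sum mulr_sumr.
    apply: eq_bigr => h _.
    rewrite rmorphM [X in _ * (X * _) = _](conjc_real (x h)).
    by rewrite [X in _ * (_ * X) = _](esym (chrN k h)) mulrCA.
  rewrite mulr_sumr rmorph_sum; apply: eq_bigr => h _.
  rewrite fourier_inv -rmorphM ffunE; congr (_ %:C).
  rewrite mulrCA; congr (_ * _); rewrite mulr_sumr; apply: eq_bigr => g _.
  by rewrite mulrCA.
have := congr1 (@complex.Re R) E; rewrite complexRe_sum /= => <-.
by apply: eq_bigr => k _; rewrite complexReMr.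
Qed.

Lemma fourier_norm x : \sum_k sqnormc (fourier x k) = #|{: G}|%:R * inner x x.
Proof.
have := fourier_quadratic (fun g => (g == 0)%:R) x.
have -> : \sum_h \sum_g (g == 0)%:R * (x h * x (h - g)) = inner x x.
  apply: eq_bigr => h _; rewrite (bigD1 0)//= eqxx mul1r subr0 big1 ?addr0// => g g0.
  by rewrite (negPf g0) mul0r.
move=> <-; apply: eq_bigr => k _.
rewrite (bigD1 0)//= eqxx chr0 big1 ?addr0 => [|g g0].
  by rewrite mulr1/= mul1r.
by rewrite (negPf g0) mul0r.
Qed.

Lemma fourier_trivial x : fourier x 0 = (inner x (all_one R G))%:C.
Proof.
rewrite rmorph_sum; apply: eq_bigr => g _.
by rewrite chrC chr0 mulr1 ffunE mulr1.
Qed.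

End Characters.

(** * The eigenvalue gap *)

Section EigenvalueGap.
Variables (R : realType) (d : nat) (n : 'I_d -> nat) (om : 'I_d -> R[i]).
Hypothesis n_gt1 : forall i, (1 < n i)%N.
Hypothesis n_2_or_4 : forall i, n i = 2%N \/ (4 %| n i)%N.
Hypothesis om_prim : forall i, (n i).-primitive_root (om i).
Local Notation G := (lee_group n).
Local Notation "r %:C" := (real_complex R r).
Implicit Types (g h k : G) (x : {ffun G -> R}).

Lemma n_half i : n i = (n i)./2.*2.
Proof.
by case: (n_2_or_4 i) => [->//|/dvdnP[m ->]]; rewrite -[4%N]/(2 * 2)%N mulnA muln2 doubleK.
Qed.

Lemma half_lt i : ((n i)./2 < n i)%N.
Proof. by rewrite {2}n_half -addnn -{1}[(n i)./2]addn0 ltn_add2l half_gt0. Qed.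

(** The index of the character (-1)^(j_1 + ... + j_d), as [om i ^+ (n i)./2] is -1. *)
Definition checker_index : G := [ffun i => inZp (n i)./2].

Lemma checker_index_val i : checker_index i = (n i)./2 :> nat.
Proof. by rewrite ffunE /= Zp_cast// modn_small// half_lt. Qed.

Lemma om_half i : om i ^+ (n i)./2 = -1.
Proof.
have /eqP := prim_expr_order (om_prim i).
rewrite {1}n_half -muln2 exprM sqrf_eq1 => /orP[|/eqP//].
rewrite -{1}[1](expr0 (om i)) (eq_prim_root_expr (om_prim i)).
by rewrite mod0n modn_small ?half_lt// => /eqP h0; have := n_gt1 i; rewrite n_half h0.
Qed.

Definition parity_sign g : R := (-1) ^+ odd (\sum_i (g i : nat))%N.

Lemma chr_checker g : chr om checker_index g = (parity_sign g)%:C.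
Proof.
rewrite /chr (eq_bigr (fun i => (-1) ^+ (g i : nat))) => [|i _].
  by rewrite prodrXr -signr_odd /parity_sign rmorphXn rmorphN1.
by rewrite checker_index_val exprM om_half.
Qed.

(** Taking the real part of [z ^+ (n i)./2] loses nothing: that power is 1 or -1. *)
Definition coord_eig i (j : 'Z_(n i)) (q : R) : R :=
  let z := om i ^+ j in cyc_eig (n i)./2 (complex.Re z) (complex.Re (z ^+ (n i)./2)) q.

Lemma om_norm i (j : nat) : `|om i ^+ j| = 1.
Proof.
apply/eqP; rewrite -(@pexpr_eq1 _ _ (n i)) ?(ltnW (n_gt1 i))//.
by rewrite -normrX exprAC (prim_expr_order (om_prim i)) expr1n normr1.
Qed.

Lemma om_half_pow i (j : nat) :
  (om i ^+ j) ^+ (n i)./2 = 1 \/ (om i ^+ j) ^+ (n i)./2 = -1.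
Proof.
rewrite exprAC om_half -signr_odd; case: odd; [by right|by left].
Qed.

Lemma coord_eigE i (j : 'Z_(n i)) q : 0 < q < 1 ->
  \sum_(l : 'Z_(n i)) q%:C ^+ cyc_weight (n i) l * om i ^+ (j * l) =
  (coord_eig j q)%:C.
Proof.
move=> q01; rewrite /coord_eig.
rewrite -(cyc_eigE q01 (om_norm i j)); first last.
- by case: (om_half_pow i j) => ->; rewrite ?(rmorphN1, rmorph1).
- by rewrite -n_half exprAC (prim_expr_order (om_prim i)) expr1n.
rewrite -n_half.
rewrite -(big_mkord xpredT (fun l => q%:C ^+ cyc_weight (n i) l * om i ^+ (j * l))).
rewrite {1}(Zp_cast (n_gt1 i)) big_mkord; apply: eq_bigr => l _.
by rewrite exprM.
Qed.

Lemma Re_om_range i (j : nat) : -1 <= complex.Re (om i ^+ j) <= 1.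
Proof.
have := om_norm i j; case: (om i ^+ j) => a b /(congr1 (fun z => z ^+ 2)).
rewrite -add_Re2_Im2 expr1n => /(congr1 (@complex.Re R)) /= ab.
rewrite -ler_norml -(@expr_le1 _ 2)// real_normK ?num_real// -ab lerDl sqr_ge0 //.
Qed.

(** The only point of the unit circle with real part -1 is -1, reached by powers of [om i] below
    [n i] at the exponent n_i / 2 alone. *)
Lemma Re_om_gtN1 i (j : 'Z_(n i)) : j != checker_index i ->
  -1 < complex.Re (om i ^+ j).
Proof.
move=> jne; have /andP[lo _] := Re_om_range i j.
rewrite lt_neqAle lo andbT; apply: contraNneq jne => reE.
have : om i ^+ j = om i ^+ (n i)./2.
  rewrite om_half; have := om_norm i j; move: reE.
  case: (om i ^+ j) => a b /= <- /(congr1 (fun z => z ^+ 2)).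
  rewrite -add_Re2_Im2 expr1n => /(congr1 (@complex.Re R)) /= /eqP.
  rewrite sqrrN expr1n addrC -subr_eq0 addrK sqrf_eq0 => /eqP ->.
  by apply/eqP; rewrite eq_complex/= oppr0 !eqxx.
move/eqP; rewrite (eq_prim_root_expr (om_prim i)).
rewrite !modn_small ?half_lt ?lt_Zp_val// => /eqP e.
by apply/eqP/val_inj; rewrite /= checker_index_val.
Qed.

Lemma coord_eig_ineq i (j : 'Z_(n i)) q : 0 < q < 1 ->
  (1 - q) ^+ 2 / 2 <= coord_eig (checker_index i) q /\
  coord_eig (checker_index i) q +
    (1 + complex.Re (om i ^+ j)) / 8 * (q * (1 - q) ^+ 2) <= coord_eig j q.
Proof.
move=> q01; rewrite /coord_eig checker_index_val om_half.
case: (n_2_or_4 i) => [n2|n4].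
  have -> : (n i)./2 = 1%N by rewrite n2.
  rewrite !expr1; apply: cyc_eig_ineq1 => //.
  have := om_half_pow i j; rewrite (_ : (n i)./2 = 1%N) ?n2// expr1.
  by case=> ->; [left|right].
(* A multiple of 4 has an even half, so the root -1 comes with e = 1, where the numerator of
   [cyc_eig] is least. *)
have [m nm] := dvdnP n4; have hm : (n i)./2 = m.*2.
  by rewrite nm -[4%N]/(2 * 2)%N mulnA !muln2 doubleK.
have := half_lt i; rewrite hm -[(-1) ^+ m.*2]signr_odd odd_double expr0.
move=> m0; apply: cyc_eig_ineq_even => //.
- by have := n_gt1 i; lia.
- exact: Re_om_range.
- by have := om_half_pow i j; rewrite hm => -[] ->; [left|right].
Qed.

(* The generating polynomial of the off-diagonal kernel at k, divided by 'X so
   that its moments involve the values of f at positive integers only. *)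
Definition eig_poly k : {poly R} :=
  \sum_(g | g != 0) complex.Re (chr om k g) *: 'X^((lee_weight g).-1).

Lemma lee_weight_gt0 g : g != 0 -> (0 < lee_weight g)%N.
Proof.
rewrite lt0n; apply: contraNneq => w0.
have [p [_ pl sp]] := lee_weight_path n_gt1 g 0.
by move: sp pl; rewrite subr0 w0 => /size0nil -> /= ->.
Qed.

(** Both q^(lee_weight g) and the characters are products over the coordinates, so the sum over the
    group factors. The term g = 0 is the 1, and the factor [q] restores the exponent lowered in
    [eig_poly]. *)
Lemma eig_polyE k q : 0 < q < 1 ->
  1 + q * (eig_poly k).[q] = \prod_i coord_eig (k i) q.
Proof.
move=> q01.
have EC : \sum_g (q ^+ lee_weight g)%:C * chr om k g =
    (\prod_i coord_eig (k i) q)%:C.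
  rewrite rmorph_prod -(eq_bigr _ (fun i _ => coord_eigE (k i) q01)).
  rewrite (bigA_distr_dffun (fun i (l : 'Z_(n i)) =>
    q%:C ^+ cyc_weight (n i) l * om i ^+ (k i * l))).
  apply: eq_bigr => g _; rewrite big_split/=; congr (_ * _).
  by rewrite rmorphXn -prodrXr.
have <- : \sum_g q ^+ lee_weight g * complex.Re (chr om k g) =
    \prod_i coord_eig (k i) q.
  apply: etrans (congr1 (@complex.Re R) EC).
  by rewrite complexRe_sum; apply: eq_bigr => g _; rewrite complexReMl.
rewrite (bigD1 0)//= lee_weight0 chr0 mulr1.
congr (_ + _); rewrite /eig_poly horner_sum mulr_sumr; apply: eq_bigr => g g0.
rewrite hornerZ hornerXn mulrCA -exprS prednK ?lee_weight_gt0//.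
by rewrite mulrC.
Qed.

(** The real part of the multiplier of the energy kernel at [chr om k], as it enters
    [fourier_quadratic]. *)
Definition eig (f : R -> R) k : R := complex.Re
  (\sum_g (if g == 0 then 0 else f (lee_weight g)%:R)%:C * chr om k g).

Lemma eig_moment f k : eig f k = moment (fun i => f i.+1%:R) (eig_poly k).
Proof.
rewrite /eig complexRe_sum /eig_poly linear_sum/= [RHS]big_mkcond.
apply: eq_bigr => g _; rewrite complexReMl; case: eqVneq => [|g0]; first by rewrite mul0r.
rewrite linearZ/= -['X^_]mulr1 -(expr0 (1 - 'X)) moment_XnM1BXn/=.
by rewrite prednK ?lee_weight_gt0// mulrC.
Qed.

(** A coordinate [i] where [k] differs from the checkerboard index contributes a gap of order q(1 -
    q)^2. Each of the [e] other factors is at least its checkerboard value, itself at least (1 -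
    q)^2 / 2. The products thus differ by a multiple of q(1 - q)^(2 + 2e), as [moment_gt0]
    requires. *)
Lemma eig_gap f k : completely_monotonic f -> k != checker_index ->
  eig f checker_index < eig f k.
Proof.
move=> cmf kk0.
have [i ki] : exists i, k i != checker_index i.
  apply/existsP; rewrite -negb_forall; apply: contra kk0 => /forallP e.
  by apply/eqP/ffunP => i; apply/eqP.
rewrite -subr_gt0 !eig_moment -linearB/=.
pose e := #|[pred j : 'I_d | j != i]|.
pose c : R := (1 + complex.Re (om i ^+ k i)) / 8 / 2 ^+ e.
have c0 : 0 < c.
  have := Re_om_gtN1 ki; rewrite /c => c1.
  by rewrite !divr_gt0 ?exprn_gt0//; lra.
apply: (moment_gt0 (completely_monotonic_cm_seq cmf) c0 (b := (2 + 2 * e)%N)) => q q01.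
have q0 : 0 < q by case/andP: q01.
have q1 : 0 < 1 - q by rewrite subr_gt0; case/andP: q01.
rewrite -(ler_pM2l q0) hornerD hornerN.
have := eig_polyE checker_index q01; have := eig_polyE k q01.
rewrite (bigD1 i)//= [X in _ -> _ = X -> _](bigD1 i)//=.
set PA := \prod_(j | j != i) coord_eig (k j) q.
set PB := \prod_(j | j != i) coord_eig (checker_index j) q.
have h0 : 0 <= (1 - q) ^+ 2 / 2 by rewrite divr_ge0// sqr_ge0.
have coordB (j : 'I_d) := (coord_eig_ineq (k j) q01).1.
have PB0 : ((1 - q) ^+ 2 / 2) ^+ e <= PB.
  rewrite /e -prodr_const; apply: ler_prod => j _.
  by rewrite h0 coordB.
have PAB : PB <= PA.
  apply: ler_prod => j _; rewrite (le_trans h0 (coordB j))/=.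
  apply: le_trans (coord_eig_ineq (k j) q01).2; rewrite lerDl.
  have /andP[cj _] := Re_om_range j (k j).
  by rewrite !mulr_ge0 ?sqr_ge0 ?invr_ge0//; lra.
have [B0 AB] := coord_eig_ineq (k i) q01.
move: (coord_eig (k i) q) (coord_eig _ q) B0 AB => a b B0 AB hA hB.
have h1 : 0 <= ((1 - q) ^+ 2 / 2) ^+ e by rewrite exprn_ge0.
have c'0 : 0 <= (1 + complex.Re (om i ^+ k i)) / 8 * (q * (1 - q) ^+ 2).
  have /andP[cj _] := Re_om_range i (k i).
  by rewrite !mulr_ge0 ?sqr_ge0 ?invr_ge0//; lra.
have -> : q * (c * (1 - q) ^+ (2 + 2 * e)) =
    (1 + complex.Re (om i ^+ k i)) / 8 * (q * (1 - q) ^+ 2) *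
    ((1 - q) ^+ 2 / 2) ^+ e.
  by rewrite /c exprD exprM expr_div_n; ring.
(* Since [PB <= PA], the difference of products a PA - b PB is at least (a - b) PB. *)
have s1 : (1 + complex.Re (om i ^+ k i)) / 8 * (q * (1 - q) ^+ 2) *
    ((1 - q) ^+ 2 / 2) ^+ e <= (a - b) * PB by rewrite ler_pM//; lra.
have s2 : (a - b) * PB + b * PB <= a * PA.
  by rewrite -mulrDl subrK ler_wpM2l//; lra.
lra.
Qed.
End EigenvalueGap.

(** * Energies of configurations *)

Section Energy.
Variables (R : realType) (G : finZmodType) (u : G -> G -> R).
Hypothesis u_transl : forall g h, u g h = u (g - h) 0.

(** Extending the kernel by 0 at the origin puts the energy in the form of [fourier_quadratic]. *)
Lemma inner_energy_kernel (x : {ffun G -> R}) :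
  inner x (energy_kernel u x) =
  \sum_h \sum_g (if g == 0 then 0 else u g 0) * (x h * x (h - g)).
Proof.
apply: eq_bigr => h _; rewrite ffunE mulr_sumr big_mkcond; apply: eq_bigr => g _.
by case: eqP => _ /=; [rewrite mul0r|rewrite mulrCA].
Qed.

Lemma energy_at_transl (S : {set G}) h :
  energy_at u S h = \sum_(g | g != 0) u g 0 * (h - g \in S)%:R.
Proof.
rewrite /energy_at (reindex_inj (subrI h)) [RHS]big_mkcond [LHS]big_mkcond.
apply: eq_bigr => g _; rewrite !inE -subr_eq0 addrAC subrr add0r oppr_eq0.
rewrite u_transl subKr; case: (_ != 0) => //=.
by case: (_ \in S); rewrite ?mulr1 ?mulr0.
Qed.

Lemma energy_tot_inner (S : {set G}) :
  energy_tot u S = inner (char_vec R S) (energy_kernel u (char_vec R S)).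
Proof.
rewrite /energy_tot /inner big_mkcond; apply: eq_bigr => h _; rewrite !ffunE.
case: (h \in S); rewrite ?mul0r// mul1r energy_at_transl.
by apply: eq_bigr => g _; rewrite ffunE.
Qed.

Lemma inner_char_vec1 (S : {set G}) :
  inner (char_vec R S) (all_one R G) = #|S|%:R.
Proof.
rewrite -sum1_card natr_sum big_mkcond; apply: eq_bigr => g _.
by rewrite !ffunE mulr1; case: (g \in S).
Qed.

Lemma inner_char_vec (S : {set G}) :
  inner (char_vec R S) (char_vec R S) = #|S|%:R.
Proof.
rewrite -inner_char_vec1; apply: eq_bigr => g _.
by rewrite !ffunE; case: (g \in S); rewrite ?mulr1 ?mulr0 ?mul0r.
Qed.

Lemma char_vec_inj : injective (@char_vec R G).
Proof.
move=> S T /ffunP ST; apply/setP => g; have := ST g; rewrite !ffunE => /eqP.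
by rewrite eqr_nat; case: (g \in S); case: (g \in T).
Qed.

Lemma energy_tot_le_max (S : {set G}) : energy_tot u S <= #|S|%:R * energy_max u S.
Proof.
rewrite /energy_tot mulr_natl -sumr_const; apply: ler_sum => h hS.
by rewrite /energy_max (bigD1 h)//= le_max lexx.
Qed.

Lemma energy_tot_eq_max (S : {set G}) (e : R) : 0 <= e -> (0 < #|S|)%N ->
  {in S, forall h, energy_at u S h = e} -> energy_tot u S = #|S|%:R * energy_max u S.
Proof.
move=> e0 S0 Se; have -> : energy_max u S = e.
  have [h hS] := card_gt0P S0; apply/le_anti/andP; split; last first.
    by rewrite /energy_max (bigD1 h)//= le_max Se// lexx.
  (* The default value 0 of the iterated maximum stays below [e] by [e0]. *)
  by rewrite /energy_max; elim/big_ind: _ => // [a b ae be|g /Se ->//]; rewrite ge_max ae.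
by rewrite /energy_tot (eq_bigr (fun=> e)) ?sumr_const ?mulr_natl//; exact: Se.
Qed.
End Energy.

(** * Spectral form of the energy and its minimum *)

Section Checkerboard.
Variables (R : realType) (d : nat) (n : 'I_d -> nat) (om : 'I_d -> R[i]) (f : R -> R).
Hypothesis d_gt0 : (0 < d)%N.
Hypothesis n_gt1 : forall i, (1 < n i)%N.
Hypothesis n_2_or_4 : forall i, n i = 2%N \/ (4 %| n i)%N.
Hypothesis om_prim : forall i, (n i).-primitive_root (om i).
Hypothesis f_cm : completely_monotonic f.
Local Notation G := (lee_group n).
Local Notation "r %:C" := (real_complex R r).
Local Notation u := (lee_potential f : G -> G -> R).
Local Notation k0 := (checker_index n).
Local Notation N := (#|{: G}|%:R : R).
Implicit Types (g h k : G) (x : {ffun G -> R}).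

Definition half_feasible x := inner x x = N / 2 /\ inner x (all_one R G) = N / 2.

Lemma card_lee_group_gt0 : 0 < N.
Proof. by rewrite ltr0n; apply/card_gt0P; exists 0. Qed.

Lemma lee_potential_transl g h : u g h = u (g - h) 0.
Proof. by rewrite /lee_potential !lee_distE// subr0. Qed.

Lemma checker_index_neq0 : k0 != 0.
Proof.
apply/eqP => /ffunP/(_ (Ordinal d_gt0))/(congr1 val) /=.
rewrite checker_index_val// [RHS]/= ffunE /= => h0.
by have := n_gt1 (Ordinal d_gt0); rewrite (n_half n_2_or_4) h0.
Qed.

Lemma parity_sign_sqr g : parity_sign R g ^+ 2 = 1.
Proof. by rewrite /parity_sign sqrr_sign. Qed.

Lemma char_vec_parity (b : bool) g :
  char_vec R (parity_set n b) g = (1 + (-1) ^+ b * parity_sign R g) / 2.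
Proof.
rewrite ffunE inE /parity_sign; case: odd; case: b => /=;
  by rewrite ?expr1 ?expr0; field.
Qed.

(** The energy when all Fourier mass lies at 0 and [k0]: of the total N^2 / 2 given by
    [fourier_norm], the share at 0 is (N / 2)^2, leaving N^2 / 4 for [k0]. *)
Definition energy_min : R := (eig om f (0 : G) + eig om f k0) * N / 4.

(** The constraint on (x|1) fixes the coefficient at 0, and [fourier_norm] eliminates the one at
    [k0]; every other character is left with its excess over the eigenvalue at [k0]. *)
Lemma energy_spectral x : half_feasible x ->
  N * inner x (energy_kernel u x) = N * energy_min +
  \sum_(k | (k != 0) && (k != k0))
     (eig om f k - eig om f k0) * sqnormc (fourier om x k).
Proof.
move=> [xx x1].
have E : \sum_k eig om f k * sqnormc (fourier om x k) =
    N * inner x (energy_kernel u x).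
  rewrite inner_energy_kernel -(fourier_quadratic n_gt1 om_prim).
  apply: eq_bigr => k _; congr (complex.Re _ * _); apply: eq_bigr => g _.
  by rewrite /lee_potential lee_distE// subr0.
rewrite -E; have := fourier_norm n_gt1 om_prim x.
rewrite (bigD1 0)//= (bigD1 k0) ?checker_index_neq0//=.
rewrite [X in _ -> X = _](bigD1 0)//= [X in _ -> _ + X = _](bigD1 k0) ?checker_index_neq0//=.
rewrite fourier_trivial x1 xx.
have -> : sqnormc (N / 2)%:C = (N / 2) ^+ 2 by rewrite /sqnormc/=; ring.
under [X in _ -> _ = _ + X]eq_bigr do rewrite mulrBl.
rewrite sumrB -mulr_sumr /energy_min.
set X := \sum_(_ | _) _ => hX; set Y := sqnormc _ in hX *.
have -> : Y = N * (N / 2) - (N / 2) ^+ 2 - X by rewrite -hX; ring.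
by field.
Qed.

Lemma energy_min_le x : half_feasible x -> energy_min <= inner x (energy_kernel u x).
Proof.
move=> /energy_spectral E; rewrite -(ler_pM2l card_lee_group_gt0) E lerDl.
apply: sumr_ge0 => k /andP[_ kk0]; rewrite mulr_ge0 ?sqnormc_ge0// subr_ge0.
by rewrite ltW// eig_gap.
Qed.

(** Equality kills every Fourier coefficient except those at 0 and [k0], so x = 1/2 + r * sign. Then
    x^2 - x is the constant r^2 - 1/4, and (x|x) = (x|1) forces r = 1/2 or r = -1/2. *)
Lemma energy_min_eq x : half_feasible x -> inner x (energy_kernel u x) = energy_min ->
  exists b, x = char_vec R (parity_set n b).
Proof.
move=> xf; have [xx x1] := xf; move: (energy_spectral xf) => + e; rewrite e.
rewrite -{1}[N * _]addr0 => /addrI /esym /eqP; rewrite psumr_eq0 => [|k /andP[_ kk0]]; last first.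
  by rewrite mulr_ge0 ?sqnormc_ge0// subr_ge0 ltW// eig_gap.
move=> /allP F0; pose r : R := complex.Re (fourier om x k0) / N.
have xE g : x g = 1 / 2 + r * parity_sign R g.
  have N0 : N != 0 by rewrite gt_eqF// card_lee_group_gt0.
  apply: (mulfI N0); have := congr1 (@complex.Re R) (fourier_inv n_gt1 om_prim x g).
  rewrite [RHS]/= => <-; rewrite complexRe_sum (bigD1 0)//= (bigD1 k0) ?checker_index_neq0//=.
  rewrite big1 ?addr0 => [|k kk]; last first.
    have := F0 k (mem_index_enum _); rewrite kk/= mulf_eq0 subr_eq0.
    have /andP[_ kk0] := kk.
    by rewrite gt_eqF ?eig_gap//= => /eqP /sqnormc_eq0 ->; rewrite mul0r.
  rewrite fourier_trivial x1 chrC chr0 mulr1 chrN// chr_checker// [conjc _]conjc_real.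
  rewrite complexReMr /r/=; field.
  exact: N0.
have r2 : r ^+ 2 = 1 / 4.
  have : \sum_g (x g * x g - x g * all_one R G g) = 0.
    by rewrite sumrB -/(inner x x) -/(inner x _) xx x1 subrr.
  rewrite (eq_bigr (fun=> r ^+ 2 - 1 / 4)) => [|g _]; last first.
    rewrite ffunE mulr1 xE; have := parity_sign_sqr g; move: (parity_sign R g) => s s2.
    have -> : r ^+ 2 = r ^+ 2 * s ^+ 2 by rewrite s2 mulr1.
    by field.
  rewrite sumr_const => /eqP; rewrite mulrn_eq0 -[_ == 0%N]negbK -lt0n -(ltr0n R).
  by rewrite card_lee_group_gt0/= subr_eq0 => /eqP.
have : (r - 1 / 2) * (r + 1 / 2) = 0 by rewrite -subr_sqr r2; field.
move=> /eqP; rewrite mulf_eq0 => /orP[]/eqP rE.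
  exists false; apply/ffunP => g; rewrite xE char_vec_parity.
  by rewrite (_ : r = 1 / 2); [field|lra].
exists true; apply/ffunP => g; rewrite xE char_vec_parity.
by rewrite (_ : r = - (1 / 2)); [field|lra].
Qed.

Lemma sum_parity_sign : \sum_(g : G) parity_sign R g = 0.
Proof.
apply: (@complexI R); transitivity (\sum_(g : G) chr om k0 g).
  by rewrite rmorph_sum; apply: eq_bigr => g _; rewrite chr_checker.
under eq_bigr do rewrite chrC.
by rewrite sum_chr// (negPf checker_index_neq0) muln0.
Qed.

Lemma parity_half_feasible b : half_feasible (char_vec R (parity_set n b)).
Proof.
suff e : inner (char_vec R (parity_set n b)) (all_one R G) = N / 2.
  by split=> //; rewrite inner_char_vec -inner_char_vec1.
transitivity (\sum_(g : G) (1 / 2 + (-1) ^+ b / 2 * parity_sign R g)).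
  by apply: eq_bigr => g _; rewrite char_vec_parity !ffunE; field.
rewrite big_split/= -[X in _ + X]mulr_sumr sum_parity_sign mulr0 addr0 sumr_const.
by rewrite -[LHS]mulr_natl div1r.
Qed.

(** A checkerboard vector combines the trivial character and the one at [k0], so by orthogonality no
    excess term of [energy_spectral] remains. *)
Lemma parity_energy b : inner (char_vec R (parity_set n b))
  (energy_kernel u (char_vec R (parity_set n b))) = energy_min.
Proof.
have N0 : N != 0 by rewrite gt_eqF// card_lee_group_gt0.
apply: (mulfI N0); rewrite (energy_spectral (parity_half_feasible b)).
rewrite big1 ?addr0// => k /andP[k_neq0 kk0].
suff -> : fourier om (char_vec R (parity_set n b)) k = 0.
  by rewrite /sqnormc/= expr0n addr0 mulr0.
transitivity (\sum_(g : G) ((1 / 2)%:C * chr om g k + ((-1) ^+ b / 2)%:C * chr om g (k0 + k))).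
  apply: eq_bigr => g _; rewrite char_vec_parity chrD// ![chr _ g _]chrC chr_checker//.
  by rewrite mulrA -rmorphM -mulrDl -rmorphD; congr (_ %:C * _); field.
rewrite big_split/= -!mulr_sumr !sum_chr// (negPf k_neq0) muln0 mulr0 add0r.
suff -> : (k0 + k == 0) = false by rewrite muln0 mulr0.
(* [k0] is its own opposite, so k0 + k = 0 would give k = k0. *)
apply/negP => /eqP kE; case/eqP: kk0; apply: (addrI k0); rewrite kE; apply/esym/ffunP => i.
apply/val_inj; rewrite [(k0 + k0) i]ffunE [(0 : G) i]ffunE.
apply: etrans (val_ZpD _ _ (n_gt1 i)) _.
by rewrite !checker_index_val// addnn -n_half// modnn.
Qed.

Lemma card_parity b : #|parity_set n b| = (#|{: G}| %/ 2)%N.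
Proof.
have [_] := parity_half_feasible b; rewrite inner_char_vec1 => e.
have : #|{: G}|%:R = (#|parity_set n b| * 2)%:R :> R by rewrite natrM e; field.
by move=> /eqP; rewrite eqr_nat => /eqP ->; rewrite mulnK.
Qed.

Lemma char_vec_half_feasible (S : {set G}) : #|S| = (#|{: G}| %/ 2)%N ->
  half_feasible (char_vec R S).
Proof.
move=> cS; have [e1 e2] := parity_half_feasible false.
by rewrite /half_feasible inner_char_vec inner_char_vec1 cS -(card_parity false)
  -inner_char_vec1.
Qed.

Lemma parity_signB g h : parity_sign R (g - h) = parity_sign R g * parity_sign R h.
Proof.
apply: (@complexI R); rewrite -(chr_checker n_gt1 n_2_or_4 om_prim) rmorphM.
rewrite chrD// chrN//; congr (_ * _); first exact: chr_checker.
by rewrite chr_checker//; exact: conjc_real.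
Qed.

(** For [h] in the class, [h - g] stays in it exactly when [g] is even; the value therefore depends
    neither on [h] nor on [b]. *)
Lemma energy_at_parity b h : h \in parity_set n b ->
  energy_at u (parity_set n b) h =
  \sum_(g | g != 0) u g 0 * char_vec R (parity_set n false) g.
Proof.
move=> hb; rewrite (energy_at_transl lee_potential_transl).
apply: eq_bigr => g _; congr (_ * _).
have := char_vec_parity b h; have := char_vec_parity b (h - g).
rewrite ffunE => ->; rewrite ffunE hb parity_signB mulrA char_vec_parity => e.
have -> : (-1) ^+ b * parity_sign R h = 1 by move: e; rewrite /= mulr1n; lra.
by rewrite expr0.
Qed.

End Checkerboard.

(** * Minimisers of the fractional, total and maximal energies *)

Theorem theorem5p3 (R : realType) (d : nat) (n : 'I_d -> nat) (f : R -> R)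
    (d_ge1 : (1 <= d)%N)
    (n_gt0 : forall i : 'I_d, (0 < n i)%N)
    (n_2_or_4 : forall i : 'I_d, n i = 2%N \/ (4 %| n i)%N)
    (f_cm : completely_monotonic f) :
  let u : lee_group n -> lee_group n -> R := lee_potential f in
  [/\ forall x : {ffun lee_group n -> R},
        is_minimiser
          (fun y : {ffun lee_group n -> R} =>
             inner y y = #|{: lee_group n}|%:R / 2 /\
             inner y (all_one R (lee_group n)) = #|{: lee_group n}|%:R / 2)
          (fun y : {ffun lee_group n -> R} => inner y (energy_kernel u y)) x
        <-> x = char_vec R (S_even n) \/ x = char_vec R (S_odd n),
      forall S : {set lee_group n},
        is_minimiser
          (fun X : {set lee_group n} => #|X| = (#|{: lee_group n}| %/ 2)%N)
          (energy_tot u) S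
        <-> S = S_even n \/ S = S_odd n
    & forall S : {set lee_group n},
        is_minimiser
          (fun X : {set lee_group n} => #|X| = (#|{: lee_group n}| %/ 2)%N)
          (energy_max u) S
        <-> S = S_even n \/ S = S_odd n].
Proof.
move=> u.
have n_gt1 i : (1 < n i)%N.
  case: (n_2_or_4 i) => [->//|/(dvdn_leq (n_gt0 i))]; exact: leq_trans.
have om_ex i : {z : R[i] | (n i).-primitive_root z}.
  exact/cid/closed_prim_root_exists.
pose om i := sval (om_ex i); have om_prim i : (n i).-primitive_root (om i) := svalP (om_ex i).
have two_cases (T : Type) (F : bool -> T) x :
    (x = F false \/ x = F true) <-> exists b, x = F b.
  by split=> [[]->|[[] ->]]; [exists false|exists true|right|left].
pose parity := parity_set n; pose m := energy_min n om f.
have half_parity b := parity_half_feasible d_ge1 n_gt1 n_2_or_4 om_prim b.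
have le_m x := energy_min_le d_ge1 n_gt1 n_2_or_4 om_prim f_cm (x := x).
have eq_m x := energy_min_eq d_ge1 n_gt1 n_2_or_4 om_prim f_cm (x := x).
have E_parity b := parity_energy f d_ge1 n_gt1 n_2_or_4 om_prim b.
have card_par b : #|parity b| = (#|{: lee_group n}| %/ 2)%N :=
  card_parity d_ge1 n_gt1 n_2_or_4 om_prim b.
have half_char (S : {set lee_group n}) : #|S| = (#|{: lee_group n}| %/ 2)%N ->
    half_feasible (char_vec R S) :=
  char_vec_half_feasible d_ge1 n_gt1 n_2_or_4 om_prim (S := S).
have u_transl : forall g h, u g h = u (g - h) 0 := lee_potential_transl f n_gt1.
have tot_le_m (S : {set lee_group n}) : #|S| = (#|{: lee_group n}| %/ 2)%N -> m <= energy_tot u S.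
  by move=> cS; rewrite energy_tot_inner//; exact/le_m/half_char.
have tot_parity b : energy_tot u (parity b) = m.
  by rewrite energy_tot_inner// E_parity.
have tot_eq_m (S : {set lee_group n}) : #|S| = (#|{: lee_group n}| %/ 2)%N -> energy_tot u S <= m ->
    exists b, S = parity b.
  move=> cS Sm; have [|b /char_vec_inj] := eq_m _ (half_char S cS); last by exists b.
  by rewrite -energy_tot_inner//; apply/le_anti; rewrite Sm tot_le_m.
have half_gt0 : (0 < #|{: lee_group n}| %/ 2)%N.
  rewrite -(card_par false); apply/card_gt0P; exists 0.
  by rewrite inE big1// => i _; rewrite ffunE.
have max_parity b : m = (#|{: lee_group n}| %/ 2)%:R * energy_max u (parity b).
  rewrite -(tot_parity b) -(card_par b).
  apply: (energy_tot_eq_max (e := \sum_(g | g != 0) u g 0 * char_vec R (parity false) g)).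
  - apply: sumr_ge0 => g g0; rewrite ffunE mulr_ge0 ?ler0n// /u /lee_potential.
    rewrite lee_distE// subr0.
    have [|_] := f_cm 0%N (lee_weight g)%:R; first by rewrite ltr0n lee_weight_gt0.
    by rewrite expr0 mul1r => /ltW.
  - by rewrite card_par.
  - by move=> h; exact: energy_at_parity.
have K0 : 0 < (#|{: lee_group n}| %/ 2)%:R :> R by rewrite ltr0n.
split=> [x|S|S].
- rewrite (two_cases _ (fun b => char_vec R (parity b))).
  split=> [[xf xmin]|[b ->]].
    apply: eq_m => //; apply/le_anti; rewrite le_m// andbT.
    by rewrite -(E_parity false); exact/xmin/half_parity.
  by split=> [|y yf]; [exact: half_parity|rewrite E_parity; exact: le_m].
- rewrite (two_cases _ parity); split=> [[cS Smin]|[b ->]].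
    by apply: tot_eq_m => //; rewrite -(tot_parity false) Smin.
  by split=> // y yf; rewrite tot_parity tot_le_m.
- rewrite (two_cases _ parity); split=> [[cS Smin]|[b ->]].
    apply: tot_eq_m => //; apply: (le_trans (energy_tot_le_max _ _)).
    by rewrite cS (max_parity false) ler_pM2l// Smin.
  split=> // y yf; rewrite -(ler_pM2l K0) -max_parity -yf.
  exact: le_trans (tot_le_m _ yf) (energy_tot_le_max _ _).
Qed.
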